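(* Let $N$ be even, $L=N/2$, and let $(g_\lambda,E_\lambda,M_\lambda)_{\lambda\in\Lambda}$ be a painless finite system of bands on $\mathbb{R}^N$, with band analysis operators $T_\lambda$, band synthesis contributions $S_\lambda$, packing $P$, routers $R_\lambda$ and dual routers $\widetilde R_\lambda$ as defined in the context. Let $\dagger$ denote the adjoint of a real-linear map with respect to the real inner product $\langle u,v\rangle_{\mathbb{R}}=\operatorname{Re}(u^Hv)$ (on $\mathbb{R}^N$ this is the usual inner product). Then for every $\lambda\in\Lambda$, $$T_\lambda^\dagger=\frac{L}{M_\lambda}\,P^{-1}F_L^{-1}R_\lambda^\dagger F_{M_\lambda},\qquad S_\lambda^\dagger=\frac{M_\lambda}{L}\,F_{M_\lambda}^{-1}\widetilde R_\lambda^\dagger F_L P .$$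
   Context: **Fourier matrices.** $F_n\in\mathbb{C}^{n\times n}$ has entries $[F_n]_{kj}=e^{-2\pi i kj/n}$, $0\le k,j\le n-1$, and $F_n^{-1}=\frac1n F_n^H$. **Bands.** $N$ is even and $\Lambda$ is a finite index set. Each band $\lambda\in\Lambda$ has a length $M_\lambda$, a real spectral window $g_\lambda=(g_{\lambda,k})_{0\le k<N}\in\mathbb{R}^N$, and a selection matrix $E_\lambda\in\mathbb{R}^{M_\lambda\times N}$ with entries in $\{0,1\}$, which places the bins $k$ with $g_{\lambda,k}\neq 0$ into distinct slots. That is, there is an injective map $\sigma_\lambda$ from $\{k: g_{\lambda,k}\ne0\}$ to $\{0,\dots,M_\lambda-1\}$ with $[E_\lambda]_{m,k}=1$ if $g_{\lambda,k}\neq0$ and $m=\sigma_\lambda(k)$, and $[E_\lambda]_{m,k}=0$ otherwise. If $m=\sigma_\lambda(k)$, one says that entry $m$ of band $\lambda$ holds bin $k$. The system is painless: for every $\lambda\in\Lambda$ the map $\sigma_\lambda:\{k: g_{\lambda,k}\ne0\}\to\{0,\dots,M_\lambda-1\}$ is injective, and every bin is covered, meaning $a_k:=\sum_\lambda M_\lambda g_{\lambda,k}^2>0$ for $0\le k\le N/2$. Put $h_{\lambda,k}=M_\lambda g_{\lambda,k}/a_k$ for $0\le k\le N/2$. **Analysis.** $T_\lambda:\mathbb{R}^N\to\mathbb{C}^{M_\lambda}$ is $T_\lambda x=F_{M_\lambda}^{-1}E_\lambda\,\mathrm{diag}(g_\lambda)F_Nx$. **Packing.** $L=N/2$, and $P:\mathbb{R}^N\to\mathbb{C}^L$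 is $(Px)_j=x_{2j}+i\,x_{2j+1}$, $0\le j<L$. Its inverse $P^{-1}$ unpacks each complex entry into two real ones. **Router.** Let $\omega_k=e^{-2\pi i k/N}$. $R_\lambda:\mathbb{C}^L\to\mathbb{C}^{M_\lambda}$ is the real-linear map $$[R_\lambda Z]_m=\tfrac12 g_{\lambda,k}\bigl[(1-i\omega_k)Z_{k\bmod L}+(1+i\omega_k)\overline{Z_{-k\bmod L}}\bigr]$$ if entry $m$ holds bin $k$, and $[R_\lambda Z]_m=0$ if entry $m$ holds no bin. **Dual router.** $\widetilde R_\lambda:\mathbb{C}^{M_\lambda}\to\mathbb{C}^L$ is the real-linear map defined as follows. For $u\in\mathbb{C}^{M_\lambda}$ put $X^{(\lambda)}_k=h_{\lambda,k}[E_\lambda^\top u]_k$ for $0\le k\le N/2$, and replace $X^{(\lambda)}_0$ and $X^{(\lambda)}_{N/2}$ by their real parts. Then $$[\widetilde R_\lambda u]_q=\tfrac12\bigl[(1+i\overline{\omega_q})X^{(\lambda)}_q+(1-i\overline{\omega_q})\overline{X^{(\lambda)}_{L-q}}\bigr],\qquad 0\le q<L.$$ **Band synthesis contribution.** $S_\lambda:\mathbb{C}^{M_\lambda}\to\mathbb{R}^N$ is $S_\lambda c_\lambda=P^{-1}F_L^{-1}\widetilde R_\lambda F_{M_\lambda}c_\lambda$; the full synthesis operator is $S(\{c_\lambda\}_\lambda)=\sum_\lambda S_\lambda c_\lambda$. *)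

(* Defs.v *)
From HB Require Import structures.
From mathcomp Require Import all_boot all_order all_algebra.
From mathcomp Require Import complex.
From mathcomp Require Import boolp classical_sets reals trigo.

Set Implicit Arguments.
Unset Strict Implicit.
Unset Printing Implicit Defensive.

Import Order.TTheory GRing.Theory Num.Theory.

Local Open Scope classical_set_scope.
Local Open Scope complex_scope.
Local Open Scope ring_scope.

(* Vectors are columns. [entry v k] reads a coordinate at a natural number,
   with value 0 when k is out of range. *)
Definition entry (K : nmodType) (n : nat) (v : 'cV[K]_n) (k : nat) : K :=
  if insub k is Some i then v i 0 else 0.

(* Representative in {0, ..., L-1} of - k modulo L (for L > 0). *)
Definition oppmod (k L : nat) : nat := (L - k %% L) %% L.

Section Fourier.
Variable R : realType.

(* exp (i t) for real t *)
Definition expi (t : R) : R[i] := cos t +i* sin t.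

Definition Fourier (n : nat) : 'M[R[i]]_n :=
  \matrix_(k < n, j < n) expi (- (2 * pi * (k * j)%N%:R / n%:R)).

Definition omega (N k : nat) : R[i] := expi (- (2 * pi * k%:R / N%:R)).

End Fourier.

Arguments Fourier R n : clear implicits.
Arguments omega R N k : clear implicits.

Section Adjoint.
Variable R : realType.

Definition dotR (n : nat) (u v : 'cV[R]_n) : R := (u^T *m v) 0 0.

(* Re (u^H v) *)
Definition dotC (n : nat) (u v : 'cV[R[i]]_n) : R :=
  complex.Re (((map_mx (@conjc R) u)^T *m v) 0 0).

(* [adjoint dotU dotV f v] is the vector w such that
   dotV (f u) v = dotU u w for all u. Such a w is unique (dotR_inj, dotC_inj)
   and exists when f is real-linear (adjointRCP, adjointCRP, adjointCCP), so
   the default value 0 is never used for the maps below. *)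
Definition adjoint (U : zmodType) (V : Type) (dotU : U -> U -> R)
    (dotV : V -> V -> R) (f : U -> V) (v : V) : U :=
  xget 0 [set w | forall u, dotV (f u) v = dotU u w].

End Adjoint.

Section Bands.
Variables (R : realType) (N : nat).
Local Notation C := R[i].
Local Notation L := (N./2).

Record band := Band {
  len : nat;
  window : 'cV[R]_N;
  slot : {k : 'I_N | window k 0 != 0} -> 'I_len
}.

(* Entry m of the band holds bin k. *)
Definition holds (b : band) (m : 'I_(len b)) (k : 'I_N) : bool :=
  if insub k is Some k' then @slot b k' == m else false.

Definition selection (b : band) : 'M[R]_(len b, N) :=
  \matrix_(m < len b, k < N) (holds m k)%:R.

Definition analysis (b : band) (x : 'cV[R]_N) : 'cV[C]_(len b) :=
  invmx (Fourier R (len b)) *m (map_mx (real_complex R) (selection b) *m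
    (diag_mx (map_mx (real_complex R) (window b))^T *m
      (Fourier R N *m map_mx (real_complex R) x))).

Definition pack (x : 'cV[R]_N) : 'cV[C]_L :=
  \col_(j < L) ((entry x j.*2)%:C + 'i%C * (entry x j.*2.+1)%:C).

(* P^-1; see packK and unpackK. *)
Definition unpack (Z : 'cV[C]_L) : 'cV[R]_N :=
  \col_(n < N) if odd n then complex.Im (entry Z n./2)
               else complex.Re (entry Z n./2).

(* When slot is injective, at most one bin is held by each entry. *)
Definition router (b : band) (Z : 'cV[C]_L) : 'cV[C]_(len b) :=
  \col_(m < len b)
    if [pick k | holds m k] is Some k then
      2^-1 * (window b k 0)%:C *
        ((1 - 'i%C * omega R N k) * entry Z (k %% L) +
         (1 + 'i%C * omega R N k) * (entry Z (oppmod k L))^*%C)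
    else 0.

Section System.
Variables (Lam : finType) (B : Lam -> band).

Definition frame_weight (k : nat) : R :=
  \sum_(l : Lam) (len (B l))%:R * entry (window (B l)) k ^+ 2.

Definition painless : Prop :=
  (forall l, injective (@slot (B l))) /\
  (forall k, (k <= L)%N -> 0 < frame_weight k).

Definition dual_window (l : Lam) (k : nat) : R :=
  (len (B l))%:R * entry (window (B l)) k / frame_weight k.

(* X^(l)_k, with the entries at k = 0 and k = N/2 replaced by their real
   parts *)
Definition half_spectrum (l : Lam) (u : 'cV[C]_(len (B l))) (k : nat) : C :=
  let X := (dual_window l k)%:C *
    entry ((map_mx (real_complex R) (selection (B l)))^T *m u) k in
  if (k == 0)%N || (k == L) then (complex.Re X)%:C else X.

Definition dual_router (l : Lam) (u : 'cV[C]_(len (B l))) : 'cV[C]_L :=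
  \col_(q < L)
    (2^-1 * ((1 + 'i%C * (omega R N q)^*%C) * half_spectrum u q +
             (1 - 'i%C * (omega R N q)^*%C) * (half_spectrum u (L - q))^*%C)).

Definition synthesis (l : Lam) (c : 'cV[C]_(len (B l))) : 'cV[R]_N :=
  unpack (invmx (Fourier R L) *m dual_router (Fourier R (len (B l)) *m c)).

End System.
End Bands.

Arguments analysis {R N} b x.
Arguments router {R N} b Z.
Arguments dual_router {R N Lam} B l u.
Arguments synthesis {R N Lam} B l c.

Section Facts.
Variable R : realType.
Local Notation C := R[i].

Lemma entryE (K : nmodType) n (v : 'cV[K]_n) (i : 'I_n) : entry v i = v i 0.
Proof. by rewrite /entry valK. Qed.

Lemma packK N : ~~ odd N -> cancel (@pack R N) (@unpack R N).
Proof.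
move=> evN x; apply/matrixP => n j; rewrite ord1 !mxE /entry.
have ltn2 : (n./2 < N./2)%N.
  by rewrite -ltn_double (even_halfK evN) (leq_ltn_trans _ (ltn_ord n)) //
             -{2}(odd_double_half n) leq_addl.
rewrite (insubT (fun k => (k < N./2)%N) ltn2) !mxE /= -!/(entry x _).
case: ifP => on; rewrite /= !(mul0r, mul1r, add0r, addr0, subr0, oppr0).
  have -> : n./2.*2.+1 = n by rewrite -[RHS]odd_double_half on.
  exact: entryE.
have -> : n./2.*2 = n by rewrite -[RHS]odd_double_half on.
exact: entryE.
Qed.

Lemma unpackK N : ~~ odd N -> cancel (@unpack R N) (@pack R N).
Proof.
move=> evN Z; apply/matrixP => j k; rewrite ord1 !mxE /entry.
have lt0 : (j.*2.+1 < N)%N.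
  by rewrite -[ltnRHS](even_halfK evN) ltn_Sdouble.
rewrite (insubT (fun k => (k < N)%N) lt0).
rewrite (insubT (fun k => (k < N)%N) (ltnW lt0)) !mxE /= odd_double /=.
rewrite uphalf_double doubleK entryE; case: (Z j 0) => a b.
apply/eqP; rewrite eq_complex /=.
by rewrite !(mul0r, mul1r, add0r, addr0, mulr0, subr0) !eqxx.
Qed.

Lemma dotCE n (u v : 'cV[C]_n) :
  dotC u v = \sum_(j < n) (complex.Re (u j 0) * complex.Re (v j 0)
                         + complex.Im (u j 0) * complex.Im (v j 0)).
Proof.
rewrite /dotC mxE (raddf_sum (@complex.Re R : Rcomplex R -> R)).
apply: eq_bigr => j _; rewrite !mxE.
by case: (u j 0) => a b; case: (v j 0) => c d; rewrite /= mulNr opprK.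
Qed.

Lemma dotRE n (u v : 'cV[R]_n) : dotR u v = \sum_(j < n) u j 0 * v j 0.
Proof. by rewrite /dotR mxE; apply: eq_bigr => j _; rewrite !mxE. Qed.

Lemma dotR_inj n (w w' : 'cV[R]_n) :
  (forall u, dotR u w = dotR u w') -> w = w'.
Proof.
move=> h; apply/matrixP => i j; rewrite ord1.
have := h (delta_mx i 0); rewrite !dotRE [LHS](bigD1 i) //= [RHS](bigD1 i) //= !big1 => [|k|k].
- by rewrite !mxE !eqxx !mul1r !addr0.
- by move=> /negPf nk; rewrite !mxE nk mul0r.
- by move=> /negPf nk; rewrite !mxE nk mul0r.
Qed.

Lemma dotC_inj n (w w' : 'cV[C]_n) :
  (forall u, dotC u w = dotC u w') -> w = w'.
Proof.
move=> h; apply/matrixP => i j; rewrite ord1.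
have H (z : C) : complex.Re z * complex.Re (w i 0)
      + complex.Im z * complex.Im (w i 0)
    = complex.Re z * complex.Re (w' i 0) + complex.Im z * complex.Im (w' i 0).
  have := h (\col_k (if k == i then z else 0)).
  rewrite !dotCE [LHS](bigD1 i) //= [RHS](bigD1 i) //= !big1 => [|k|k].
  - by rewrite !mxE !eqxx !addr0.
  - by move=> /negPf nk; rewrite !mxE nk !mul0r addr0.
  - by move=> /negPf nk; rewrite !mxE nk !mul0r addr0.
have := H 1; have := H 'i%C; rewrite /= !mul1r !mul0r !addr0 !add0r.
by case: (w i 0) => a b; case: (w' i 0) => c d /= -> ->.
Qed.

Lemma dotR_repr n (phi : 'cV[R]_n -> R) :
  {morph phi : u v / u + v} -> (forall r u, phi (r *: u) = r * phi u) ->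
  exists w, forall u, phi u = dotR u w.
Proof.
move=> phiD phiZ; exists (\col_i phi (delta_mx i 0)) => u.
have phi0 : phi 0 = 0 by rewrite -(scale0r 0) phiZ mul0r.
rewrite dotRE [in LHS](matrix_sum_delta u) (big_morph phi phiD phi0).
apply: eq_bigr => i _; rewrite (big_morph phi phiD phi0) big_ord1 phiZ !mxE.
by [].
Qed.

Lemma dotC_repr n (phi : 'cV[C]_n -> R) :
  {morph phi : u v / u + v} -> (forall r u, phi (r%:C *: u) = r * phi u) ->
  exists w, forall u, phi u = dotC u w.
Proof.
move=> phiD phiZ.
exists (\col_i (phi (delta_mx i 0) +i* phi ('i%C *: delta_mx i 0))) => u.
have phi0 : phi 0 = 0 by rewrite -(scale0r 0) (phiZ 0) mul0r.
rewrite dotCE [in LHS](matrix_sum_delta u) (big_morph phi phiD phi0).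
apply: eq_bigr => i _; rewrite (big_morph phi phiD phi0) big_ord1 !mxE /=.
rewrite -!phiZ -phiD scalerA -scalerDl; congr (phi (_ *: _)).
case: (u i 0) => a b.
apply/eqP; rewrite eq_complex /=.
by rewrite !(mulr0, mulr1, mul0r, addr0, add0r, subr0, oppr0) !eqxx.
Qed.

Lemma dotCDl n (u u' v : 'cV[C]_n) : dotC (u + u') v = dotC u v + dotC u' v.
Proof.
rewrite !dotCE -big_split; apply: eq_bigr => j _; rewrite !mxE.
by case: (u j 0) => a b; case: (u' j 0) => c d; rewrite /= !mulrDl addrACA.
Qed.

Lemma dotCZl n r (u v : 'cV[C]_n) : dotC (r%:C *: u) v = r * dotC u v.
Proof.
rewrite !dotCE mulr_sumr; apply: eq_bigr => j _; rewrite !mxE.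
by case: (u j 0) => a b; rewrite /= !mul0r subr0 addr0 mulrDr !mulrA.
Qed.

Lemma dotRDl n (u u' v : 'cV[R]_n) : dotR (u + u') v = dotR u v + dotR u' v.
Proof. by rewrite /dotR linearD mulmxDl mxE. Qed.

Lemma dotRZl n r (u v : 'cV[R]_n) : dotR (r *: u) v = r * dotR u v.
Proof. by rewrite /dotR linearZ -scalemxAl mxE. Qed.

Section Exists.
Variables m n : nat.

Lemma adjointRCP (f : 'cV[R]_n -> 'cV[C]_m) :
  {morph f : u v / u + v} -> (forall r u, f (r *: u) = r%:C *: f u) ->
  forall u v, dotC (f u) v = dotR u (adjoint (@dotR R n) (@dotC R m) f v).
Proof.
move=> fD fZ u v; rewrite /adjoint; case: xgetP => [w _ /= -> //|].
have [u1 u2|r u1|w hw /(_ w) []] := @dotR_repr n (fun u => dotC (f u) v).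
- by rewrite fD dotCDl.
- by rewrite fZ dotCZl.
- exact: hw.
Qed.

Lemma adjointCRP (f : 'cV[C]_n -> 'cV[R]_m) :
  {morph f : u v / u + v} -> (forall r u, f (r%:C *: u) = r *: f u) ->
  forall u v, dotR (f u) v = dotC u (adjoint (@dotC R n) (@dotR R m) f v).
Proof.
move=> fD fZ u v; rewrite /adjoint; case: xgetP => [w _ /= -> //|].
have [u1 u2|r u1|w hw /(_ w) []] := @dotC_repr n (fun u => dotR (f u) v).
- by rewrite fD dotRDl.
- by rewrite fZ dotRZl.
- exact: hw.
Qed.

Lemma adjointCCP (f : 'cV[C]_n -> 'cV[C]_m) :
  {morph f : u v / u + v} -> (forall r u, f (r%:C *: u) = r%:C *: f u) ->
  forall u v, dotC (f u) v = dotC u (adjoint (@dotC R n) (@dotC R m) f v).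
Proof.
move=> fD fZ u v; rewrite /adjoint; case: xgetP => [w _ /= -> //|].
have [u1 u2|r u1|w hw /(_ w) []] := @dotC_repr n (fun u => dotC (f u) v).
- by rewrite fD dotCDl.
- by rewrite fZ dotCZl.
- exact: hw.
Qed.

End Exists.

Section Linearity.
Variables (N : nat) (Lam : finType) (B : Lam -> band R N).

Lemma entryD (K : nmodType) n (u v : 'cV[K]_n) k :
  entry (u + v) k = entry u k + entry v k.
Proof. by rewrite /entry; case: insubP => [i _ _|_]; rewrite ?mxE ?addr0. Qed.

Lemma entryZ (K : pzRingType) n (r : K) (v : 'cV[K]_n) k :
  entry (r *: v) k = r * entry v k.
Proof. by rewrite /entry; case: insubP => [i _ _|_]; rewrite ?mxE ?mulr0. Qed.

Lemma ReD (x y : C) : complex.Re (x + y) = complex.Re x + complex.Re y.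
Proof. by case: x y => [a b] [c d]. Qed.

Lemma ImD (x y : C) : complex.Im (x + y) = complex.Im x + complex.Im y.
Proof. by case: x y => [a b] [c d]. Qed.

Lemma ReZ r (x : C) : complex.Re (r%:C * x) = r * complex.Re x.
Proof. by case: x => a b; rewrite /= mul0r subr0. Qed.

Lemma ImZ r (x : C) : complex.Im (r%:C * x) = r * complex.Im x.
Proof. by case: x => a b; rewrite /= mul0r addr0. Qed.

Lemma conjcZ r (x : C) : (r%:C * x)^*%C = r%:C * x^*%C.
Proof. by rewrite -[in RHS](conjc_real r) (rmorphM (@conjc R)). Qed.

Lemma analysisD (b : band R N) : {morph analysis b : u v / u + v}.
Proof. by move=> u v; rewrite /analysis map_mxD !mulmxDr. Qed.

Lemma analysisZ (b : band R N) r u : analysis b (r *: u) = r%:C *: analysis b u.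
Proof. by rewrite /analysis map_mxZ -!scalemxAr. Qed.

Lemma routerD (b : band R N) : {morph router b : u v / u + v}.
Proof.
move=> u v; apply/matrixP => m j; rewrite !mxE.
case: pickP => [k _|_]; last by rewrite addr0.
rewrite !entryD rmorphD /= -mulrDr; congr (_ * _).
by rewrite !mulrDr addrACA.
Qed.

Lemma routerZ (b : band R N) r u : router b (r%:C *: u) = r%:C *: router b u.
Proof.
apply/matrixP => m j; rewrite !mxE.
case: pickP => [k _|_]; last by rewrite mulr0.
rewrite !entryZ conjcZ [RHS]mulrCA; congr (_ * _).
by rewrite mulrDr; congr (_ + _); rewrite mulrCA.
Qed.

Lemma half_spectrumD l k :
  {morph (fun u => half_spectrum (B := B) (l := l) u k) : u v / u + v}.
Proof.
move=> u v; rewrite /half_spectrum mulmxDr entryD mulrDr.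
by case: ifP => // _; rewrite ReD rmorphD.
Qed.

Lemma half_spectrumZ l k r u :
  half_spectrum (B := B) (l := l) (r%:C *: u) k = r%:C * half_spectrum u k.
Proof.
rewrite /half_spectrum -scalemxAr entryZ mulrCA.
by case: ifP => // _; rewrite ReZ rmorphM.
Qed.

Lemma dual_routerD l : {morph dual_router B l : u v / u + v}.
Proof.
move=> u v; apply/matrixP => q j; rewrite !mxE.
rewrite !half_spectrumD rmorphD /= -mulrDr; congr (_ * _).
by rewrite !mulrDr addrACA.
Qed.

Lemma dual_routerZ l r u :
  dual_router B l (r%:C *: u) = r%:C *: dual_router B l u.
Proof.
apply/matrixP => q j; rewrite !mxE.
rewrite !half_spectrumZ conjcZ [RHS]mulrCA; congr (_ * _).
by rewrite mulrDr; congr (_ + _); rewrite mulrCA.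
Qed.

Lemma unpackD : {morph @unpack R N : u v / u + v}.
Proof.
by move=> u v; apply/matrixP => n j; rewrite !mxE entryD ReD ImD; case: ifP.
Qed.

Lemma unpackZ r (u : 'cV[C]_(N./2)) : unpack (r%:C *: u) = r *: unpack u.
Proof.
by apply/matrixP => n j; rewrite !mxE entryZ ReZ ImZ; case: ifP.
Qed.

Lemma synthesisD l : {morph synthesis B l : u v / u + v}.
Proof.
by move=> u v; rewrite /synthesis mulmxDr dual_routerD mulmxDr unpackD.
Qed.

Lemma synthesisZ l r u : synthesis B l (r%:C *: u) = r *: synthesis B l u.
Proof.
by rewrite /synthesis -scalemxAr dual_routerZ -scalemxAr unpackZ.
Qed.

End Linearity.
End Facts.

(* Main.v *)
(* The packed half-length transform determines the full spectrum of a real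
   signal, so that T = F_M^-1 R F_L P and S = P^-1 F_L^-1 R~ F_M, where R~ is
   the dual router. Since P is an isometry and F_n^H = n F_n^-1, taking
   adjoints factor by factor gives the two formulas. *)
Require Import Defs.
From mathcomp Require Import all_boot all_order all_algebra.
From mathcomp Require Import complex.
From mathcomp Require Import classical_sets reals trigo.
From mathcomp Require Import ring lra zify.

Import GRing.Theory Num.Theory.
Local Open Scope complex_scope.
Local Open Scope ring_scope.

(** * Powers, periodicity and geometric sums of roots of unity *)

Section RootsOfUnity.
Variable R : realType.

Lemma expi0 : expi (0 : R) = 1.
Proof. by rewrite /expi cos0 sin0. Qed.

Lemma expiD (s t : R) : expi (s + t) = expi s * expi t.
Proof.
rewrite /expi cosD sinD; apply/eqP; rewrite eq_complex /= eqxx /=.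
by apply/eqP; ring.
Qed.

Lemma conj_expi (t : R) : (expi t)^*%C = expi (- t).
Proof. by rewrite /expi cosN sinN. Qed.

(** By the half-angle formula the real part is 1 - 2 sin(t/2)^2, and sin(t/2) > 0 because t/2 lies
    in (0, pi). *)
Lemma expi_neq1 (t : R) : 0 < t < 2 * pi -> expi t != 1.
Proof.
move=> ht; rewrite eq_complex negb_and /=; apply/orP; left.
have s0 : 0 < sin (t / 2) by apply: sin_gt0_pi; lra.
have -> : t = t / 2 + t / 2 by lra.
rewrite cosD; apply/negP => /eqP c1.
have c2 := cos2Dsin2 (t / 2); nra.
Qed.

Lemma omegaX n k : omega R n k = omega R n 1 ^+ k.
Proof.
elim: k => [|k IHk]; first by rewrite /omega mulr0 mul0r oppr0 expi0.
rewrite exprS -IHk /omega -expiD; congr expi.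
by rewrite -natr1; ring.
Qed.

Lemma omegaD n j k : omega R n (j + k) = omega R n j * omega R n k.
Proof. by rewrite omegaX exprD -!omegaX. Qed.

Lemma omega_conjM n k : (omega R n k)^*%C * omega R n k = 1.
Proof. by rewrite /omega conj_expi -expiD addNr expi0. Qed.

Lemma omega_period n : omega R n n = 1.
Proof.
(* For [n = 0] the inverse of 0 is 0, so the exponential is taken at 0. *)
case: n => [|n]; first by rewrite /omega invr0 mulr0 oppr0 expi0.
rewrite /omega mulfK ?pnatr_eq0 // -conj_expi /expi.
by rewrite mulr_natl cos2pi sin2pi; apply: conjc1.
Qed.

Lemma omega_mod n k : omega R n (k %% n) = omega R n k.
Proof. by rewrite [LHS]omegaX expr_mod -omegaX ?omega_period. Qed.

Lemma omega_neq1 n k : (0 < k < n)%N -> omega R n k != 1.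
Proof.
(* Conjugating both sides flips the sign of the angle, which brings it into (0, 2 pi). *)
move=> /andP[k0 kn]; rewrite /omega -conj_expi -(conjc1 R).
rewrite (inj_eq (can_inj (@conjcK R))); apply: expi_neq1.
have n0 : 0 < n%:R :> R by rewrite ltr0n (leq_trans _ kn).
apply/andP; split; first by rewrite divr_gt0 // !mulr_gt0 ?pi_gt0 ?ltr0n.
by rewrite ltr_pdivrMr // ltr_pM2l ?mulr_gt0 ?pi_gt0 ?ltr0n // ltr_nat.
Qed.

Lemma omega_half N k : ~~ odd N -> omega R (N./2) k = omega R N k.*2.
Proof.
move=> evN; rewrite /omega; congr (expi (- _)).
have -> : N%:R = (N./2)%:R * 2 :> R by rewrite -natrM muln2 even_halfK.
by rewrite -muln2 natrM invfM [in RHS]mulrA mulrACA mulfV ?pnatr_eq0 // mulr1.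
Qed.

Lemma FourierE n (k j : 'I_n) : Fourier R n k j = omega R n (k * j).
Proof. by rewrite mxE. Qed.

(** A geometric sum with ratio w, where w^n = 1 and w - 1 is nonzero. *)
Lemma sum_omega n (k : nat) :
  (0 < k < n)%N -> \sum_(j < n) omega R n (k * j) = 0.
Proof.
move=> hk; have /negPf w1 := omega_neq1 n k hk.
have wn : omega R n k ^+ n = 1.
  by rewrite omegaX -exprM mulnC exprM -omegaX omega_period expr1n.
under eq_bigr => j _ do rewrite omegaX exprM -omegaX.
have /esym/eqP := subrX1 (omega R n k) n.
by rewrite wn subrr mulf_eq0 subr_eq0 w1 => /eqP.
Qed.

End RootsOfUnity.

(** * Orthogonality of the Fourier matrix and its adjoint *)

Section FourierAdjoint.
Variable R : realType.
Local Notation C := R[i].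

Lemma conj_Fourier_mul n :
  map_mx (@conjc R) (Fourier R n) *m Fourier R n = (n%:R)%:M.
Proof.
apply/matrixP => k j; rewrite !mxE.
have conj_sum m : (0 < m < n)%N -> \sum_(i < n) (omega R n (m * i))^*%C = 0.
  move=> hm; rewrite -(rmorph_sum (@conjc R)) (sum_omega R n m hm).
  exact: conjc0.
under eq_bigr => i _ do rewrite mxE !FourierE (mulnC i).
(* Subtraction on [nat] is truncated, so the off-diagonal entries split in two: a vanishing sum of
   frequency j - k, or the conjugate of one of frequency k - j. *)
case: (ltngtP k j) => [kj|jk|/val_inj ->].
- have /negPf -> : k != j by rewrite -val_eqE /= ltn_eqF.
  apply: etrans (sum_omega R n (j - k) _); last by have := ltn_ord j; lia.
  apply: eq_bigr => i _.
  by rewrite -{1}(subnKC (ltnW kj)) mulnDl omegaD mulrA omega_conjM mul1r.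
- have /negPf -> : k != j by rewrite -val_eqE /= gtn_eqF.
  apply: etrans (conj_sum (k - j)%N _); last by have := ltn_ord k; lia.
  apply: eq_bigr => i _; rewrite -{1}(subnKC (ltnW jk)) mulnDl omegaD.
  by rewrite (rmorphM (@conjc R)) mulrAC omega_conjM mul1r.
- under eq_bigr do rewrite omega_conjM.
  by rewrite sumr_const card_ord eqxx.
Qed.

Lemma invmx_Fourier n : (0 < n)%N ->
  invmx (Fourier R n) = n%:R^-1 *: map_mx (@conjc R) (Fourier R n).
Proof.
move=> n0; have nz : n%:R != 0 :> C by rewrite pnatr_eq0 -lt0n.
have e : (n%:R^-1 *: map_mx (@conjc R) (Fourier R n)) *m Fourier R n = 1%:M.
  by rewrite -scalemxAl conj_Fourier_mul scale_scalar_mx mulVf.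
have [_ uF] := mulmx1_unit e.
by rewrite -[RHS](mulmxK uF) e mul1mx.
Qed.

Lemma trmx_Fourier n : (Fourier R n)^T = Fourier R n.
Proof. by apply/matrixP => k j; rewrite !mxE mulnC. Qed.

Lemma dotCC n (u v : 'cV[C]_n) : dotC u v = dotC v u.
Proof.
rewrite !dotCE; apply: eq_bigr => j _.
by congr (_ + _); rewrite mulrC.
Qed.

Lemma dotCZr n r (u v : 'cV[C]_n) : dotC u (r%:C *: v) = r * dotC u v.
Proof. by rewrite dotCC dotCZl dotCC. Qed.

Lemma dotRZr n r (u v : 'cV[R]_n) : dotR u (r *: v) = r * dotR u v.
Proof. by rewrite /dotR -scalemxAr mxE. Qed.

Lemma natrC n : (n%:R : C) = (n%:R)%:C.
Proof. by rewrite rmorph_nat. Qed.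

(** The Fourier matrix is symmetric, so its conjugate transpose is its conjugate, which is n times
    the inverse. For [n = 0] both sides are empty sums. *)
Lemma dotC_Fourier n (u v : 'cV[C]_n) :
  dotC (Fourier R n *m u) v = n%:R * dotC u (invmx (Fourier R n) *m v).
Proof.
case: n u v => [|n] u v; first by rewrite !dotCE !big_ord0 mulr0.
rewrite -dotCZr -natrC invmx_Fourier // scalemxAl scalerA.
rewrite mulfV ?pnatr_eq0 // scale1r /dotC map_mxM trmx_mul -mulmxA.
by rewrite (map_trmx (@conjc R) (Fourier R _)) trmx_Fourier.
Qed.

Lemma dotC_invFourier n (u v : 'cV[C]_n) :
  dotC (invmx (Fourier R n) *m u) v = n%:R^-1 * dotC u (Fourier R n *m v).
Proof.
case: n u v => [|n] u v; first by rewrite !dotCE !big_ord0 mulr0.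
by rewrite [in RHS]dotCC dotC_Fourier mulKf ?pnatr_eq0 // dotCC.
Qed.

(** Reduces each adjoint formula to checking the defining identity for the proposed vector;
    nondegeneracy of the inner product pins down the choice made by [xget]. *)
Lemma adjoint_eq (U : zmodType) (V : Type) (dotU : U -> U -> R)
    (dotV : V -> V -> R) (f : U -> V) v w :
  (forall w1 w2, (forall u, dotU u w1 = dotU u w2) -> w1 = w2) ->
  (forall u, dotV (f u) v = dotU u w) -> adjoint dotU dotV f v = w.
Proof.
move=> dot_inj fw; apply: xget_unique => // w' fw'.
by apply: dot_inj => u; rewrite -fw -fw'.
Qed.

End FourierAdjoint.

(** * Packing as an isometry, and the full spectrum from the half-length transform *)

Section Packing.
Variables (R : realType) (N : nat).
Hypothesis evenN : ~~ odd N.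
Local Notation C := R[i].
Local Notation L := (N./2).

Lemma sum_even_odd (V : nmodType) (f : nat -> V) :
  \sum_(i < N) f i = \sum_(j < L) (f j.*2 + f j.*2.+1).
Proof.
rewrite -(big_mkord xpredT) -{1}(even_halfK evenN) big_mkord.
elim: L => [|n IHn]; first by rewrite !big_ord0.
by rewrite doubleS !big_ord_recr /= IHn addrA.
Qed.

Lemma entry_pack (x : 'cV[R]_N) (j : 'I_L) :
  pack x j 0 = entry x j.*2 +i* entry x j.*2.+1.
Proof.
by rewrite mxE; apply/eqP; rewrite eq_complex /=; apply/andP; split;
  apply/eqP; ring.
Qed.

(** The isometry of packing in adjoint form: even samples pair with real parts, odd samples with
    imaginary parts. *)
Lemma dotR_unpack (x : 'cV[R]_N) Z : dotR x (unpack Z) = dotC (pack x) Z.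
Proof.
rewrite dotRE dotCE.
rewrite (eq_bigr (fun i : 'I_N => entry x i * entry (unpack Z) i)); last first.
  by move=> i _; rewrite !entryE.
rewrite (sum_even_odd _ (fun i => entry x i * entry (unpack Z) i)).
apply: eq_bigr => j _; rewrite entry_pack /=.
by rewrite -{3 4}(unpackK evenN Z) entry_pack.
Qed.

Lemma entry_Fourier_mod n (v : 'cV[C]_n) k : (0 < n)%N ->
  entry (Fourier R n *m v) (k %% n) = \sum_(j < n) omega R n (k * j) * v j 0.
Proof.
move=> n0; rewrite -[(k %% n)%N]/(val (Ordinal (ltn_pmod k n0))) entryE mxE.
by apply: eq_bigr => j _; rewrite FourierE /= -omega_mod modnMml omega_mod.
Qed.

(** Both sides are inverses of the same number: the exponents add up to a multiple of n, and on the
    unit circle the conjugate is the inverse. *)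
Lemma omega_oppmod n k j : (0 < n)%N ->
  omega R n ((n - k %% n) * j) = (omega R n (k * j))^*%C.
Proof.
move=> n0; set a := omega R n _; set b := omega R n _.
have ab : a * b = 1.
  rewrite /a /b -(omega_mod _ _ (k * j)) -modnMml omega_mod -omegaD -mulnDl.
  rewrite subnK; last by rewrite ltnW // ltn_pmod.
  by rewrite -omega_mod modnMr /omega mulr0 mul0r oppr0 expi0.
have cb : b^*%C * b = 1 by apply: omega_conjM.
by rewrite -[RHS]mul1r -ab -mulrA [b * _]mulrC cb mulr1.
Qed.

(* The two half-length Fourier transforms of the even and odd samples are
   recovered from the packed one as (Z_k + conj Z_(-k)) / 2 and
   (Z_k - conj Z_(-k)) / 2i; a radix-2 step then combines them. *)
Lemma Fourier_pack (x : 'cV[R]_N) (k : 'I_N) :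
  let Z := Fourier R L *m pack x in
  2^-1 * ((1 - 'i%C * omega R N k) * entry Z (k %% L) +
          (1 + 'i%C * omega R N k) * (entry Z (oppmod k L))^*%C) =
  (Fourier R N *m map_mx (real_complex R) x) k 0.
Proof.
move=> Z; have L0 : (0 < L)%N.
  by rewrite -double_gt0 (even_halfK evenN) (leq_ltn_trans _ (ltn_ord k)).
have conjM (y z : C) : (y * z)^*%C = y^*%C * z^*%C by exact: (rmorphM (@conjc R)).
have conj_sum n (F : 'I_n -> C) : (\sum_i F i)^*%C = \sum_i (F i)^*%C.
  exact: (rmorph_sum (@conjc R)).
(* The reductions modulo L, including the outer one in [oppmod], disappear by periodicity of the
   kernel. *)
rewrite /oppmod !entry_Fourier_mod // conj_sum.
rewrite !mulr_sumr -big_split mulr_sumr /= mxE.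
rewrite (eq_bigr (fun i : 'I_N => omega R N (k * i) * (entry x i)%:C));
  last first.
  by move=> i _; rewrite FourierE mxE entryE.
rewrite (sum_even_odd _ (fun i => omega R N (k * i) * (entry x i)%:C)).
apply: eq_bigr => j _.
(* The two conjugations of the kernel at -k cancel, so both terms carry the same factor, and only
   the packed sample stays conjugated. *)
rewrite omega_oppmod // conjM conjcK omega_half //.
rewrite -doubleMr mulnS omegaD -doubleMr !entry_pack.
set w := omega R N k; set z := omega R N _.
set a := entry x _; set b := entry x _.
have -> : a +i* b = a%:C + 'i%C * b%:C.
  by apply/eqP; rewrite eq_complex /=; apply/andP; split; apply/eqP; ring.
have -> : (a%:C + 'i%C * b%:C)^*%C = a%:C - 'i%C * b%:C.
  by apply/eqP; rewrite eq_complex /=; apply/andP; split; apply/eqP; ring.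
have i2 : 'i%C * 'i%C = -1 :> C by rewrite -expr2 sqr_i.
transitivity (2^-1 * 2 * (z * (a%:C - 'i%C * 'i%C * w * b%:C))); first by ring.
by rewrite i2 mulVf ?pnatr_eq0 // mul1r; ring.
Qed.

(** This yields the factorization of [analysis] through [router]: each row of the selection matrix
    keeps at most one bin, whose value is given by [Fourier_pack]. *)
Lemma router_Fourier_pack (b : band R N) (x : 'cV[R]_N) :
  injective (@slot R N b) ->
  router b (Fourier R L *m pack x) =
  map_mx (real_complex R) (selection b) *m
    (diag_mx (map_mx (real_complex R) (window b))^T *m
      (Fourier R N *m map_mx (real_complex R) x)).
Proof.
move=> slot_inj; apply/matrixP => m j; rewrite ord1 [LHS]mxE [RHS]mxE.
have selE k : map_mx (real_complex R) (selection b) m k = (holds m k)%:R.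
  by rewrite !mxE rmorph_nat.
have diagE (y : 'cV[C]_N) k :
    (diag_mx (map_mx (real_complex R) (window b))^T *m y) k 0 =
    (window b k 0)%:C * y k 0.
  by rewrite mul_diag_mx !mxE.
under eq_bigr => k _ do rewrite selE diagE.
case: pickP => [k hk|h0]; last first.
  by rewrite big1 // => k _; rewrite h0 mul0r.
rewrite (bigD1 k) //= hk big1 ?addr0 ?mul1r => [|k' k'k]; last first.
  suff -> : holds m k' = false by rewrite mul0r.
  (* Two bins held by the same entry coincide by injectivity of [slot]. *)
  apply: contraNF k'k; move: hk; rewrite /holds.
  case: insubP => // u _ <- /eqP <-; case: insubP => // u' _ <- /eqP.
  by move=> /slot_inj ->.
by rewrite -Fourier_pack [2^-1 * _]mulrC -mulrA.
Qed.

End Packing.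

Theorem mainTheorem3 (R : realType) (N : nat) (Lam : finType)
    (B : Lam -> band R N) (evenN : ~~ odd N) (painlessB : painless B)
    (l : Lam) :
  let L := N./2 in
  let M := len (B l) in
  (forall v : 'cV[R[i]]_M,
     adjoint (@dotR R N) (@dotC R M) (analysis (B l)) v =
     (L%:R / M%:R) *:
       unpack (invmx (Fourier R L) *m
         adjoint (@dotC R L) (@dotC R M) (router (B l))
           (Fourier R M *m v))) /\
  (forall x : 'cV[R]_N,
     adjoint (@dotC R M) (@dotR R N) (synthesis B l) x =
     (M%:R / L%:R) *:
       (invmx (Fourier R M) *m
         adjoint (@dotC R M) (@dotC R L) (dual_router B l)
           (Fourier R L *m pack x))).
Proof.
move=> L M; split=> [v|x]; apply: adjoint_eq.
- exact: dotR_inj.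
(* Moving the inverse transform across the inner product absorbs the factor L; the factor 1/M is
   matched below by the inverse transform in [analysis]. *)
- move=> u; rewrite dotRZr dotR_unpack // mulrAC -dotC_Fourier.
  (* The adjoint identity is available because the router, despite its conjugation, is
     real-linear. *)
  rewrite -adjointCCP; first last.
  + exact: routerZ.
  + exact: routerD.
  rewrite router_Fourier_pack //; last by case: painlessB.
  by rewrite /analysis dotC_invFourier mulrC.
- exact: dotC_inj.
- move=> c.
  have dotRC (y z : 'cV[R]_N) : dotR y z = dotR z y.
    by rewrite !dotRE; apply: eq_bigr => j _; rewrite mulrC.
  rewrite /synthesis dotRC dotR_unpack // dotCC dotC_invFourier.
  rewrite adjointCCP; first last.
  + exact: dual_routerZ.
  + exact: dual_routerD.
  (* Here M/L scales a complex vector, so it is first rewritten as an embedded real in order to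
     leave the real inner product. *)
  rewrite dotC_Fourier !natrC -(fmorphV (real_complex R)).
  by rewrite -(rmorphM (real_complex R)) dotCZr mulrCA mulrA.
Qed.
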